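(* Let $p$ be a prime number, let $k$ be a field of characteristic $p$, let $\mathfrak{S}_n$ be the symmetric group on $n$ letters, and let $B$ be a block of the group algebra $k\mathfrak{S}_n$ with non-trivial defect groups. Then $H\!H^1(B)\neq 0$.
   Context: For a finite-dimensional $k$-algebra $A$ and $r\ge 0$, $H\!H^r(A)=\mathrm{Ext}^r_{A\otimes_k A^{\mathrm{op}}}(A,A)$ denotes the degree $r$ Hochschild cohomology of $A$ over $k$. A block of $kG$ (for $G$ a finite group) is an indecomposable direct factor $B$ of $kG$ as an algebra; its defect groups are $p$-subgroups of $G$, defined up to conjugacy in the usual sense of modular representation theory. *)

(* Defs.v *)
From HB Require Import structures.
From mathcomp Require Import all_boot all_order all_algebra all_fingroup.
From mathcomp Require Import falgebra boolp functions freeg.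

Set Implicit Arguments.
Unset Strict Implicit.
Unset Printing Implicit Defensive.

Import GRing.Theory.
Local Open Scope ring_scope.

(* -------------------------------------------------------------------- *)
Section GroupAlgebra.
Variables (k : fieldType) (gT : finGroupType).

(* An alias: {ffun gT -> k} already carries the pointwise product. *)
Definition galg := {ffun gT -> k^o}.

HB.instance Definition _ := Vector.copy galg {ffun gT -> k^o}.

Implicit Types a b c : galg.

Definition galg_one : galg := [ffun g => (g == 1%g)%:R].
Definition galg_mul a b : galg :=
  [ffun g => \sum_x (a x : k) * b (x^-1 * g)%g].

Lemma galg_mulA : associative galg_mul.
Proof.
move=> a b c; apply/ffunP => g; rewrite !ffunE.
under [RHS]eq_bigr => y _ do rewrite ffunE mulr_suml.
rewrite exchange_big /=; apply: eq_bigr => x _; rewrite ffunE mulr_sumr.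
rewrite [RHS](reindex_inj (mulgI x)) /=; apply: eq_bigr => y _.
by rewrite mulrA mulKg invMg mulgA.
Qed.

Lemma galg_mul1 : left_id galg_one galg_mul.
Proof.
move=> a; apply/ffunP => g; rewrite ffunE (bigD1 1%g) //= ffunE eqxx mul1r.
rewrite invg1 mul1g big1 ?addr0 // => x /negbTE x1.
by rewrite ffunE x1 mul0r.
Qed.

Lemma galg_mulr1 : right_id galg_one galg_mul.
Proof.
move=> a; apply/ffunP => g; rewrite ffunE (bigD1 g) //= ffunE.
rewrite mulVg eqxx mulr1 big1 ?addr0 // => x xg.
by rewrite ffunE -eq_mulVg1 (negbTE xg) mulr0.
Qed.

Lemma galg_mulDl : left_distributive galg_mul +%R.
Proof.
move=> a b c; apply/ffunP => g; rewrite !ffunE -big_split /=.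
by apply: eq_bigr => x _; rewrite ffunE mulrDl.
Qed.

Lemma galg_mulDr : right_distributive galg_mul +%R.
Proof.
move=> a b c; apply/ffunP => g; rewrite !ffunE -big_split /=.
by apply: eq_bigr => x _; rewrite ffunE mulrDr.
Qed.

Lemma galg_oner_neq0 : galg_one != 0.
Proof.
by apply/eqP => /ffunP/(_ 1%g)/eqP; rewrite !ffunE eqxx oner_eq0.
Qed.

HB.instance Definition _ := GRing.Zmodule_isNzRing.Build galg
  galg_mulA galg_mul1 galg_mulr1 galg_mulDl galg_mulDr galg_oner_neq0.

Lemma galg_scaleAl (z : k) a b : z *: (a * b) = z *: a * b.
Proof.
apply/ffunP => g; rewrite !ffunE scaler_sumr; apply: eq_bigr => x _.
by rewrite ffunE -mulrA.
Qed.

HB.instance Definition _ := GRing.Lmodule_isLalgebra.Build k galg galg_scaleAl.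

Lemma galg_scaleAr (z : k) a b : z *: (a * b) = a * (z *: b).
Proof.
apply/ffunP => g; rewrite !ffunE scaler_sumr; apply: eq_bigr => x _.
by rewrite ffunE /GRing.scale /= mulrCA.
Qed.

HB.instance Definition _ := GRing.Lalgebra_isAlgebra.Build k galg galg_scaleAr.
HB.instance Definition _ := Algebra_isFalgebra.Build k galg.

Definition gelt (g : gT) : galg := [ffun h => (h == g)%:R].

Lemma gelt1 : gelt 1%g = 1. Proof. by []. Qed.

Lemma geltM g h : gelt (g * h)%g = gelt g * gelt h.
Proof.
apply/ffunP => x; rewrite !ffunE (bigD1 g) //= !ffunE eqxx mul1r big1 ?addr0.
  by rewrite -(inj_eq (mulgI g) (_ * x)%g) mulKVg.
by move=> y /negbTE yg; rewrite ffunE yg mul0r.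
Qed.

Definition gconj a (g : gT) : galg := gelt g^-1 * a * gelt g.

Definition gfixed (D : {set gT}) a : Prop := forall g, g \in D -> gconj a g = a.

(* The relative trace Tr_D^G; on D-fixed elements each summand depends on
   the coset only. *)
Definition reltrace (D : {set gT}) a : galg :=
  \sum_(C in rcosets D [set: gT]) gconj a (repr C).

End GroupAlgebra.

(* -------------------------------------------------------------------- *)
Section Blocks.
Variables (k : fieldType) (A : falgType k).

Definition two_sided_ideal (U I : {vspace A}) : Prop :=
  [/\ (I <= U)%VS, (U * I <= I)%VS & (I * U <= I)%VS].

Definition direct_factor (U I : {vspace A}) : Prop :=
  two_sided_ideal U I /\
  exists J, [/\ two_sided_ideal U J, (I + J)%VS = U & (I :&: J)%VS = 0%VS].

Definition indecomposable_alg (U : {vspace A}) : Prop :=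
  U <> 0%VS /\
  forall I J : {vspace A}, two_sided_ideal U I -> two_sided_ideal U J ->
    (I + J)%VS = U -> (I :&: J)%VS = 0%VS -> I = 0%VS \/ J = 0%VS.

(* The identity element algid B of a block B is its block idempotent. *)
Definition is_block (B : {aspace A}) : Prop :=
  direct_factor fullv B /\ indecomposable_alg B.

End Blocks.

(* D is minimal such that the block idempotent lies in Tr_D^G((kG)^D). *)
Section DefectGroups.
Variables (k : fieldType) (gT : finGroupType).

Definition in_trace_ideal (B : {aspace galg k gT}) (D : {set gT}) : Prop :=
  exists2 a : galg k gT, gfixed D a & reltrace D a = algid B.

Definition is_defect_group (B : {aspace galg k gT}) (D : {group gT}) : Prop :=
  in_trace_ideal B D /\
  forall Q : {group gT}, Q \proper D -> ~ in_trace_ideal B Q.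

End DefectGroups.

(* -------------------------------------------------------------------- *)
(* The opposite algebra A^op is the converse ring A^c. *)
Section Opposite.
Variables (k : fieldType) (A : falgType k).

HB.instance Definition _ := Vector.copy A^c A.
HB.instance Definition _ := GRing.Lmodule_isLalgebra.Build k A^c
  (fun z a b => @scalerAr k A z b a).
HB.instance Definition _ := GRing.Lalgebra_isAlgebra.Build k A^c
  (fun z a b => @scalerAl k A z b a).

Lemma mul_converse (a b : A) : (a : A^c) * (b : A^c) = b * a.
Proof. by []. Qed.

End Opposite.

(* -------------------------------------------------------------------- *)
(* A \otimes_k B in coordinates on the bases vbasis {:A} and vbasis {:B};
   tens_lift is the universal property. *)
Section Tensor.
Variables (k : fieldType) (A B : falgType k).

Definition tens := 'M[k]_(\dim {:A}, \dim {:B}).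
HB.instance Definition _ := Vector.copy tens 'M[k]_(\dim {:A}, \dim {:B}).

Local Notation eA := (vbasis {:A}).
Local Notation eB := (vbasis {:B}).
Implicit Types X Y Z : tens.

Definition ptens (a : A) (b : B) : tens :=
  \matrix_(i, j) (coord eA i a * coord eB j b).

Definition bilinear_fun (V : lmodType k) (f : A -> B -> V) : Prop :=
  (forall b, linear (f^~ b)) /\ (forall a, linear (f a)).

Definition tens_lift (V : lmodType k) (f : A -> B -> V) X : V :=
  \sum_i \sum_j X i j *: f eA`_i eB`_j.

Lemma ptens_bilinear : bilinear_fun ptens.
Proof.
split=> [b|a] z x y; apply/matrixP => i j; rewrite !mxE linearP.
  by rewrite mulrDl mulrA.
by rewrite mulrDr mulrCA.
Qed.

Lemma tens_lift_ptens (V : lmodType k) (f : A -> B -> V) a b :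
  bilinear_fun f -> tens_lift f (ptens a b) = f a b.
Proof.
case=> fl fr.
pose F b' : {linear A -> V} :=
  HB.pack (f^~ b') (GRing.isLinear.Build _ _ _ _ _ (fl b')).
pose G a' : {linear B -> V} :=
  HB.pack (f a') (GRing.isLinear.Build _ _ _ _ _ (fr a')).
have fA b' : f a b' = \sum_i coord eA i a *: f eA`_i b'.
  rewrite {1}(coord_vbasis (memvf a)) -[LHS]/(F b' _) linear_sum.
  by apply: eq_bigr => i _; apply: (linearZZ (F b')).
have fB a' : f a' b = \sum_j coord eB j b *: f a' eB`_j.
  rewrite {1}(coord_vbasis (memvf b)) -[LHS]/(G a' _) linear_sum.
  by apply: eq_bigr => j _; apply: (linearZZ (G a')).
rewrite fA; apply: eq_bigr => i _; rewrite fB scaler_sumr.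
by apply: eq_bigr => j _; rewrite mxE scalerA.
Qed.

Lemma tens_lift_is_linear (V : lmodType k) (f : A -> B -> V) :
  linear (tens_lift f).
Proof.
move=> z X Y; rewrite /tens_lift scaler_sumr -big_split; apply: eq_bigr => i _.
rewrite scaler_sumr -big_split; apply: eq_bigr => j _.
by rewrite !mxE scalerDl scalerA.
Qed.

HB.instance Definition _ (V : lmodType k) (f : A -> B -> V) :=
  GRing.isLinear.Build k tens V _ (tens_lift f) (tens_lift_is_linear f).

Lemma eq_tens_lift (V : lmodType k) (f g : A -> B -> V) X :
  f =2 g -> tens_lift f X = tens_lift g X.
Proof. by move=> fg; do 2!apply: eq_bigr => ? _; rewrite fg. Qed.

Lemma tens_liftP (V : lmodType k) z (f g : A -> B -> V) X :
  tens_lift (fun a b => z *: f a b + g a b) X =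
  z *: tens_lift f X + tens_lift g X.
Proof.
rewrite /tens_lift scaler_sumr -big_split; apply: eq_bigr => i _.
rewrite scaler_sumr -big_split; apply: eq_bigr => j _.
by rewrite scalerDr !scalerA mulrC.
Qed.

Lemma tens_sumE X : X = \sum_i \sum_j X i j *: ptens eA`_i eB`_j.
Proof.
have fA := basis_free (vbasisP {:A}); have fB := basis_free (vbasisP {:B}).
apply/matrixP => i j; rewrite summxE (bigD1 i) //= summxE (bigD1 j) //= !mxE.
rewrite !coord_free // !eqxx !mulr1 !big1 ?addr0 // => [i' ni|j' nj].
  rewrite summxE big1 // => j' _; rewrite !mxE coord_free //.
  by rewrite [_ == _](negbTE ni) mul0r mulr0.
rewrite !mxE !coord_free //; by rewrite [_ == j](negbTE nj) !mulr0.
Qed.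

Lemma tens_ind (P : tens -> Prop) :
  P 0 -> (forall X Y, P X -> P Y -> P (X + Y)) -> (forall a b, P (ptens a b)) ->
  forall X, P X.
Proof.
move=> P0 PD Pp X; rewrite (tens_sumE X); do 2!apply: big_ind => // ? _.
rewrite -[ptens _ _]/(ptens^~ _ _).
have [fl _] := ptens_bilinear.
have -> z a b : z *: ptens a b = ptens (z *: a) b; last exact: Pp.
by apply/matrixP => i j; rewrite !mxE linearZ mulrA.
Qed.

Definition tens_one : tens := ptens 1 1.

Definition tens_mul X Y : tens :=
  tens_lift (fun a b => tens_lift (fun c d => ptens (a * c) (b * d)) Y) X.

Let mul_bil2 a b : bilinear_fun (fun c d => ptens (a * c) (b * d)).
Proof.
have [pl pr] := ptens_bilinear.
by split=> [d|c] z x y; rewrite mulrDr -scalerAr ?pl ?pr.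
Qed.

Let mul_bil1 Y :
  bilinear_fun (fun a b => tens_lift (fun c d => ptens (a * c) (b * d)) Y).
Proof.
have [pl pr] := ptens_bilinear.
by split=> [b|a] z x y; rewrite -tens_liftP; apply: eq_tens_lift => c d;
  rewrite mulrDl -scalerAl ?pl ?pr.
Qed.

Lemma tens_mulE a b c d :
  tens_mul (ptens a b) (ptens c d) = ptens (a * c) (b * d).
Proof. by rewrite /tens_mul !tens_lift_ptens. Qed.

Lemma tens_mulDl : left_distributive tens_mul +%R.
Proof. by move=> X Y Z; rewrite /tens_mul linearD. Qed.

Lemma tens_mulDr : right_distributive tens_mul +%R.
Proof.
move=> X Y Z; rewrite -[tens_mul X Y]scale1r -tens_liftP.
by apply: eq_tens_lift => a b; rewrite linearD scale1r.
Qed.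

Let tens_mul0 X : tens_mul X 0 = 0.
Proof. by apply: (addrI (tens_mul X 0)); rewrite -tens_mulDr !addr0. Qed.

Let tens_0mul X : tens_mul 0 X = 0.
Proof. exact: linear0. Qed.

Lemma tens_mulA : associative tens_mul.
Proof.
move=> X Y Z; elim/tens_ind: X => [|X X'|a b]; first by rewrite !tens_0mul.
  by rewrite !tens_mulDl => -> ->.
elim/tens_ind: Y => [|Y Y'|a' b']; first by rewrite !(tens_0mul, tens_mul0).
  by rewrite !(tens_mulDl, tens_mulDr) => -> ->.
elim/tens_ind: Z => [|Z Z'|a'' b'']; first by rewrite !tens_mul0.
  by rewrite !tens_mulDr => -> ->.
by rewrite !tens_mulE !mulrA.
Qed.

Lemma tens_mul1 : left_id tens_one tens_mul.
Proof.
move=> X; elim/tens_ind: X => [|X X'|a b]; first by rewrite tens_mul0.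
  by rewrite tens_mulDr => -> ->.
by rewrite tens_mulE !mul1r.
Qed.

Lemma tens_mulr1 : right_id tens_one tens_mul.
Proof.
move=> X; elim/tens_ind: X => [|X X'|a b]; first by rewrite tens_0mul.
  by rewrite tens_mulDl => -> ->.
by rewrite tens_mulE !mulr1.
Qed.

Lemma tens_oner_neq0 : tens_one != 0.
Proof.
have nz (C : falgType k) : exists i, coord (vbasis {:C}) i 1 != 0.
  apply/existsP; apply: contraT; rewrite negb_exists => /forallP h.
  have := coord_vbasis (memvf (1 : C)); rewrite big1 => [/eqP|i _].
    by rewrite oner_eq0.
  by move: (h i); rewrite negbK => /eqP ->; rewrite scale0r.
have [[i hi] [j hj]] := (nz A, nz B).
by apply/eqP => /matrixP/(_ i j)/eqP; rewrite !mxE mulf_eq0 (negbTE hi) (negbTE hj).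
Qed.

HB.instance Definition _ := GRing.Zmodule_isNzRing.Build tens
  tens_mulA tens_mul1 tens_mulr1 tens_mulDl tens_mulDr tens_oner_neq0.

Lemma ptensM a b c d : ptens a b * ptens c d = ptens (a * c) (b * d).
Proof. exact: tens_mulE. Qed.

End Tensor.

(* -------------------------------------------------------------------- *)
(* A as a left module over A \otimes_k A^op: (a \otimes b) m = a m b. *)
Section Regular.
Variables (k : fieldType) (A : falgType k).

Definition enveloping := tens A A^c.
HB.instance Definition _ := GRing.NzRing.on enveloping.

Definition bimod : Type := A.
HB.instance Definition _ := GRing.Zmodule.on bimod.

Definition bimod_act (X : enveloping) (m : bimod) : bimod :=
  tens_lift (fun (a : A) (b : A^c) => a * (m : A) * (b : A) : A) X.

Let act_bil (m : A) :
  bilinear_fun (fun (a : A) (b : A^c) => a * m * (b : A) : A).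
Proof.
split=> [b|a] z x y; first by rewrite !mulrDl -!scalerAl.
by rewrite mulrDr -scalerAr.
Qed.

Lemma bimod_act_ptens (a b : A) (m : A) :
  bimod_act (ptens a (b : A^c)) m = a * m * b.
Proof. exact: tens_lift_ptens. Qed.

Lemma bimod_actDl m : {morph bimod_act^~ m : X Y / X + Y}.
Proof. by move=> X Y; rewrite /bimod_act linearD. Qed.

Lemma bimod_actDr : right_distributive bimod_act +%R.
Proof.
move=> X m m'; rewrite -[bimod_act X m]scale1r -[RHS]tens_liftP.
by apply: eq_tens_lift => a b; rewrite scale1r mulrDr mulrDl.
Qed.

Lemma bimod_act1 : left_id 1 bimod_act.
Proof. by move=> m; rewrite [LHS]bimod_act_ptens mul1r mulr1. Qed.

Lemma bimod_actA X Y m : bimod_act X (bimod_act Y m) = bimod_act (X * Y) m.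
Proof.
have act0 Z : bimod_act Z 0 = 0.
  by apply: (addrI (bimod_act Z 0)); rewrite -bimod_actDr !addr0.
have act_0 m' : bimod_act 0 m' = 0 by exact: linear0.
elim/tens_ind: X => [|X X'|a b]; first by rewrite mul0r !act_0.
  by rewrite mulrDl !bimod_actDl => -> ->.
elim/tens_ind: Y => [|Y Y'|a' b']; first by rewrite mulr0 !act_0 act0.
  by rewrite mulrDr !bimod_actDl bimod_actDr => -> ->.
by rewrite ptensM !bimod_act_ptens !mulrA.
Qed.

HB.instance Definition _ := GRing.Zmodule_isLmodule.Build enveloping bimod
  bimod_actA bimod_act1 bimod_actDr bimod_actDl.

End Regular.

(* -------------------------------------------------------------------- *)
(* Hom_R(U, V) as an abelian group. *)
Section LinearMaps.
Variables (R : nzRingType) (U V : lmodType R).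

Definition islin : {pred (U -> V)} := fun f => `[< linear f >].

Lemma islinP f : reflect (linear f) (f \in islin).
Proof. exact: asboolP. Qed.

Lemma islin_zmod : zmod_closed islin.
Proof.
split=> [|f g /islinP lf /islinP lg]; apply/islinP => z x y.
  by rewrite -![0 _]/(0 : V) scaler0 addr0.
rewrite -![(f - g) _]/(f _ - g _) lf lg scalerBr opprD.
by rewrite addrACA.
Qed.
HB.instance Definition _ := GRing.isZmodClosed.Build (U -> V) islin islin_zmod.

Record homR := HomR {hom_fun :> U -> V; _ : hom_fun \in islin}.
HB.instance Definition _ := [isSub for hom_fun].
HB.instance Definition _ := [Choice of homR by <:].
HB.instance Definition _ := [SubChoice_isSubZmodule of homR by <:].

Lemma homRP (f : homR) : linear f.
Proof. by case: f => f lf; apply/islinP. Qed.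

HB.instance Definition _ (f : homR) :=
  GRing.isLinear.Build R U V _ (hom_fun f) (homRP f).

Lemma homRD (f g : homR) x : (f + g) x = f x + g x.
Proof. by []. Qed.

Lemma homRB (f g : homR) x : (f - g) x = f x - g x.
Proof. by []. Qed.

Definition mk_homR (f : {linear U -> V}) : homR :=
  HomR (introT (islinP _) (fun z => linearP f z)).
End LinearMaps.

(* -------------------------------------------------------------------- *)
(* The functorial free resolution of M: syzygy M r.+1 is the kernel of the
   map of the free module on the set syzygy M r onto syzygy M r. *)
Section FreeResolution.
Variable R : nzRingType.

Section Syzygy.
Variable M : lmodType R.

Definition cover_map : {freeg M / R} -> M := fglift id.

Lemma cover_map_is_zmod : zmod_morphism cover_map.
Proof. exact: lift_is_additive. Qed.
HB.instance Definition _ :=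
  GRing.isZmodMorphism.Build {freeg M / R} M cover_map cover_map_is_zmod.

Lemma cover_mapU (c : R) (m : M) : cover_map << c *g m >> = c *: m.
Proof. exact: liftU. Qed.

Lemma cover_mapZ : scalable cover_map.
Proof.
move=> c x; rewrite -[c *: x]/(fgscale c x) raddf_sum.
rewrite -[X in _ = c *: cover_map X]freeg_sumE raddf_sum scaler_sumr.
by apply: eq_bigr => m _; rewrite /= !cover_mapU scalerA.
Qed.
HB.instance Definition _ :=
  GRing.isScalable.Build R {freeg M / R} M _ cover_map cover_mapZ.

Definition cover_ker : {pred {freeg M / R}} := fun x => cover_map x == 0.

Lemma cover_ker_submod : submod_closed cover_ker.
Proof.
split=> [|c x y]; rewrite !unfold_in ?raddf0 //.
by move=> /eqP x0 /eqP y0; rewrite linearP /= x0 y0 scaler0 addr0.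
Qed.
HB.instance Definition _ :=
  GRing.isSubmodClosed.Build R {freeg M / R} cover_ker cover_ker_submod.

Record kernel := Kernel {kernel_val : {freeg M / R}; _ : kernel_val \in cover_ker}.
HB.instance Definition _ := [isSub for kernel_val].
HB.instance Definition _ := [Choice of kernel by <:].
HB.instance Definition _ := [SubChoice_isSubLmodule of kernel by <:].
End Syzygy.

Variable M : lmodType R.

Fixpoint syzygy (r : nat) : lmodType R :=
  if r is r'.+1 then kernel (syzygy r') else M.

Definition res (r : nat) : lmodType R := {freeg (syzygy r) / R}.

Definition res_d (r : nat) : res r.+1 -> res r :=
  fun x => kernel_val (cover_map x).

Lemma res_d_is_linear r : linear (@res_d r).
Proof. by move=> z x y; rewrite /res_d !linearP. Qed.
HB.instance Definition _ r :=
  GRing.isLinear.Build R (res r.+1) (res r) _ (@res_d r) (@res_d_is_linear r).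

Lemma res_aug_surj (m : M) : exists x : res 0, cover_map x = m.
Proof. by exists << 1 *g m >>; rewrite cover_mapU scale1r. Qed.

Lemma res_exact r (x : res r) :
  cover_map x = 0 <-> exists y : res r.+1, res_d y = x.
Proof.
split=> [/eqP x0|[y <-]]; last by apply/eqP; exact: valP (cover_map y).
by exists << 1 *g (Kernel x0 : syzygy r.+1) >>; rewrite /res_d cover_mapU scale1r.
Qed.

Lemma res_dE r (x : res r.+1) : res_d x = 0 <-> cover_map x = 0.
Proof. by split=> [x0|x0]; [apply: val_inj | rewrite /res_d x0]. Qed.

End FreeResolution.

(* -------------------------------------------------------------------- *)
(* Ext^r_R(M, N) is the r-th cohomology of Hom_R(res M, N). *)
Section Ext.
Variables (R : nzRingType) (M N : lmodType R).

Definition cochain r := homR (res M r) N.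

Definition cobd r (f : cochain r) : cochain r.+1 :=
  mk_homR (f \o @res_d R M r).

Lemma cobd_is_zmod r : zmod_morphism (@cobd r).
Proof. by move=> f g; apply: val_inj. Qed.
HB.instance Definition _ r :=
  GRing.isZmodMorphism.Build (cochain r) (cochain r.+1) (@cobd r)
    (@cobd_is_zmod r).

Definition cocycle r : {pred cochain r} := fun f => cobd f == 0.

Lemma cocycle_zmod r : zmod_closed (@cocycle r).
Proof.
split=> [|f g]; rewrite !unfold_in ?raddf0 //.
by move=> /eqP f0 /eqP g0; rewrite raddfB /= f0 g0 subr0.
Qed.
HB.instance Definition _ r :=
  GRing.isZmodClosed.Build (cochain r) (@cocycle r) (@cocycle_zmod r).

Record cocycles r :=
  Cocycle {cocycle_val : cochain r; _ : cocycle_val \in @cocycle r}.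
HB.instance Definition _ r := [isSub for @cocycle_val r].
HB.instance Definition _ r := [Choice of cocycles r by <:].
HB.instance Definition _ r := [SubChoice_isSubZmodule of cocycles r by <:].

Definition coboundary r : {pred cochain r} :=
  match r with
  | 0 => fun f => f == 0
  | s.+1 => fun f => `[< exists g : cochain s, f = cobd g >]
  end.

Definition coboundaries r : {pred cocycles r} :=
  fun z => cocycle_val z \in @coboundary r.

Lemma coboundaries_zmod r : zmod_closed (@coboundaries r).
Proof.
case: r => [|r]; split.
- by apply/eqP.
- move=> f g /eqP f0 /eqP g0; apply/eqP.
  by rewrite -[LHS]/(cocycle_val f - cocycle_val g) f0 g0 subr0.
- by apply/asboolP; exists 0; rewrite raddf0.
- move=> f g /asboolP[f' ef] /asboolP[g' eg]; apply/asboolP; exists (f' - g').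
  by rewrite -[LHS]/(cocycle_val f - cocycle_val g) ef eg raddfB.
Qed.
HB.instance Definition _ r :=
  GRing.isZmodClosed.Build (cocycles r) (@coboundaries r)
    (@coboundaries_zmod r).

Definition Ext (r : nat) : zmodType := {ideal_quot (@coboundaries r)}.

End Ext.

(* -------------------------------------------------------------------- *)
Definition HH (k : fieldType) (r : nat) (A : falgType k) : zmodType :=
  @Ext (enveloping A) (bimod A) (bimod A) r.

(* Main.v *)
Require Import Defs.
From HB Require Import structures.
From mathcomp Require Import all_boot all_order all_algebra all_fingroup falgebra.
From mathcomp Require Import cyclic pgroup boolp freeg.

(** Let [b] be the block idempotent. The first Hochschild cohomology is shown to
    be nonzero by an explicit derivation: a derivation [d] of the algebra of
    the symmetric group such that [b d] is not inner.

    Finding a [p]-cycle. As the defect groups are nontrivial, [b] is not a trace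
    from the trivial group, so some [h] in the support of [b] has a centralizer
    of order divisible by [p] and commutes with some [x] of order [p]
    ([defect_nontrivial_support]). In a symmetric group [x] may be replaced by a
    single [p]-cycle [y], one of the cycles of [x]: the cycles of [x] that are
    conjugate to [y] under the centralizer of [x] generate a normal elementary
    abelian [p]-subgroup of it, and a central idempotent with nonzero Brauer
    image at [x] cannot be supported away from the centralizer of such a subgroup
    ([support_meets_centralizer]). So the Brauer image [e] of [b] at [y], the
    part of [b] supported on the centralizer of [y], is a nonzero idempotent.

    The derivation. The centralizer of a [p]-cycle [y] is the product of the
    cyclic group of [y] and a smaller symmetric group, so it has a homomorphism
    to [k] that sends [y] to [1]. By Shapiro's lemma this yields a 1-cocycle
    [phi] with values in the permutation module on the [p]-cycles
    ([cycle_shift]) and a derivation [d] of the group algebra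
    ([cocycle_der]).

    Why it is not inner. Restrict the class of [d] to the group generated by [y]
    and keep the coefficients in the centralizer of [y]. An inner derivation
    becomes zero, and [b d] becomes [e L], where [L] is the sum of the [i^-1 y^i]
    for [0 < i < p] ([inner_kills_residue], [cycle_shift_power]). Modulo
    [(y - 1) ^ 2], [L] is the sum of a scalar and a nonzero multiple of [y - 1],
    while [e], being a nonzero idempotent, is not killed by [y - 1]; hence [e L]
    is not zero ([idem_killing_residue_eq0]).

    The passage from a derivation that is not inner to a nonzero element of
    [Ext^1] is [HH1_nonzero_of_derivation]. *)

Set Implicit Arguments.
Unset Strict Implicit.
Unset Printing Implicit Defensive.

Import GRing.Theory.
Local Open Scope ring_scope.

(** * From derivations to Ext^1 *)

Lemma freegZU (R : nzRingType) (K : choiceType) (X Y : R) (m : K) :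
  X *: << Y *g m >> = << X * Y *g m >> :> {freeg K / R}.
Proof.
apply/eqP/freeg_eqP => x; rewrite -[X *: _]/(fgscale X _) coeff_fgscale !coeffU.
by rewrite mulrA.
Qed.

Section ExtensionModule.
Variables (k : fieldType) (A : falgType k) (d : {linear A -> A}).
Hypothesis dM : forall a b, d (a * b) = d a * b + a * d b.

Lemma derivation1 : d 1 = 0.
Proof. by apply: (addrI (d 1)); rewrite addr0 -{3}[1](mulr1 1) dM mulr1 mul1r. Qed.

Definition dext : Type := (bimod A * bimod A)%type.
HB.instance Definition _ := GRing.Zmodule.on dext.

Definition dtwist (X : enveloping A) (u : A) : A :=
  tens_lift (fun (a : A) (b : A^c) => a * u * d (b : A) : A) X.

Lemma dtwist_bilinear (u : A) :
  bilinear_fun (fun (a : A) (b : A^c) => a * u * d (b : A) : A).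
Proof.
split=> [b|a] z x y; first by rewrite !mulrDl -!scalerAl.
by rewrite linearP mulrDr -scalerAr.
Qed.

Lemma dtwist_ptens (a b u : A) : dtwist (ptens a (b : A^c)) u = a * u * d b.
Proof. exact: tens_lift_ptens (dtwist_bilinear u). Qed.

Lemma dtwistDl u : {morph dtwist^~ u : X Y / X + Y}.
Proof. by move=> X Y; rewrite /dtwist linearD. Qed.

Lemma dtwistDr X : {morph dtwist X : u v / u + v}.
Proof.
move=> u v; rewrite -[dtwist X u]scale1r -[RHS]tens_liftP.
by apply: eq_tens_lift => a b; rewrite scale1r mulrDr mulrDl.
Qed.

Lemma dtwist0 X : dtwist X 0 = 0.
Proof. by apply: (addrI (dtwist X 0)); rewrite -dtwistDr !addr0. Qed.

(** The extension of the bimodule [A] by itself attached to a derivation [d]: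
    on pairs, [a] acts on the left componentwise, and [b] acts on the right by
    [(u, v) b = (u b, v b + u (d b))]. Its class in Ext^1 is that of [d]. Working
    with this module rather than with [d] means that [d] can be pulled
    back along the free cover of [A] by the universal property alone. *)
Definition dext_act (X : enveloping A) (w : dext) : dext :=
  (X *: w.1, X *: w.2 + (dtwist X w.1 : bimod A)).

Lemma dtwistM X Y u :
  dtwist (X * Y) u = bimod_act X (dtwist Y u) + dtwist X (bimod_act Y u).
Proof.
have act0 Z : bimod_act Z 0 = 0 :> A.
  by apply: (addrI (bimod_act Z 0)); rewrite -bimod_actDr !addr0.
have act_0 (m : A) : bimod_act 0 m = 0 :> A by exact: linear0.
have tw_0 m : dtwist 0 m = 0 by exact: linear0.
elim/tens_ind: X => [|X X'|a b]; first by rewrite mul0r act_0 !tw_0 addr0.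
  by rewrite mulrDl !bimod_actDl !dtwistDl => -> ->; rewrite addrACA.
elim/tens_ind: Y => [|Y Y'|a' b'].
- by rewrite mulr0 !tw_0 !act_0 !act0 dtwist0 addr0.
- move=> EY EY'; rewrite mulrDr !dtwistDl bimod_actDl dtwistDr EY EY'.
  by rewrite bimod_actDr addrACA.
rewrite ptensM.
transitivity (a * a' * u * d ((b' : A) * b)); first exact: dtwist_ptens.
have -> : dtwist (ptens a' b') u = a' * u * d b' by exact: dtwist_ptens.
have -> : dtwist (ptens a b) (bimod_act (ptens a' b') u) =
    a * (a' * u * (b' : A)) * d b.
  by rewrite [LHS]dtwist_ptens bimod_act_ptens.
by rewrite bimod_act_ptens dM mulrDr !mulrA.
Qed.

Fact dext_actA X Y w : dext_act X (dext_act Y w) = dext_act (X * Y) w.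
Proof.
case: w => u v; rewrite /dext_act /= !scalerDr !scalerA dtwistM.
by rewrite -addrA.
Qed.

Fact dext_act1 : left_id 1 dext_act.
Proof.
case=> u v; rewrite /dext_act /= !scale1r [dtwist _ _]dtwist_ptens.
by rewrite derivation1 mulr0 addr0.
Qed.

Fact dext_actDr : right_distributive dext_act +%R.
Proof.
move=> X [u v] [u' v']; rewrite /dext_act /=; congr (_, _); first exact: scalerDr.
by rewrite /= scalerDr [dtwist _ _]dtwistDr addrACA.
Qed.

Fact dext_actDl w : {morph dext_act^~ w : X Y / X + Y}.
Proof.
case: w => u v X Y; rewrite /dext_act /=; congr (_, _); first exact: scalerDl.
by rewrite /= scalerDl [dtwist _ _]dtwistDl addrACA.
Qed.

Definition dext_lmod : lmodType (enveloping A) :=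
  HB.pack dext (GRing.Zmodule_isLmodule.Build (enveloping A) dext
    dext_actA dext_act1 dext_actDr dext_actDl).


Definition dext_fst (w : dext_lmod) : bimod A := w.1.
Definition dext_snd (w : dext_lmod) : bimod A := w.2.

(** The lift of the cover of [A] to the extension. Its first component is the
    cover itself, so on the first syzygy it takes values in the submodule
    [0 x A], that is in [A], where it is the cocycle of [d]. *)
Definition dext_lift : {freeg (bimod A) / enveloping A} -> dext_lmod :=
  fglift (fun m : bimod A => (m, 0) : dext_lmod).

Fact dext_lift_is_zmod : zmod_morphism dext_lift.
Proof. exact: lift_is_additive. Qed.
HB.instance Definition _ :=
  GRing.isZmodMorphism.Build _ dext_lmod dext_lift dext_lift_is_zmod.

Lemma dext_liftU (X : enveloping A) (m : bimod A) :
  dext_lift << X *g m >> = X *: ((m, 0) : dext_lmod).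
Proof. exact: liftU. Qed.

Lemma dext_liftZ (X : enveloping A) x : dext_lift (X *: x) = X *: dext_lift x.
Proof.
rewrite -[X *: x]/(fgscale X x) raddf_sum -[in RHS](freeg_sumE x) raddf_sum.
rewrite scaler_sumr.
by apply: eq_bigr => m _; rewrite /= !dext_liftU scalerA.
Qed.

Lemma dext_fst_lift x : dext_fst (dext_lift x) = cover_map x.
Proof.
rewrite -(freeg_sumE x) !raddf_sum /=.
rewrite (big_morph dext_fst (id1 := 0) (op1 := +%R)) //.
by apply: eq_bigr => m _; rewrite dext_liftU cover_mapU.
Qed.

Lemma dext_snd_ker_linear :
  linear (fun x : kernel (bimod A) => dext_snd (dext_lift (kernel_val x))).
Proof.
move=> X x y.
have -> : dext_lift (kernel_val (X *: x + y)) =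
    X *: dext_lift (kernel_val x) + dext_lift (kernel_val y).
  by rewrite -dext_liftZ -raddfD.
rewrite /dext_snd /=.
have -> : (dext_lift (kernel_val x)).1 = 0 :> bimod A.
  by rewrite -[LHS]/(dext_fst _) dext_fst_lift; apply/eqP; exact: (valP x).
by rewrite [dtwist _ _]dtwist0 addr0.
Qed.

(** If the cocycle of [d] were the coboundary of [g], then [g] would agree with
    the lift on every difference of two generators with the same image in [A].
    Comparing the generator at [b] with the multiples of the generator at [1] by
    [b] on the right and on the left gives [d b = u b - b u] for [u] the value
    of [g] at the generator [1]. *)
Lemma HH1_nonzero_of_derivation :
  ~ (exists u, forall b, d b = u * b - b * u) -> exists x : HH 1 A, x != 0.
Proof.
move=> outer.
(* The cocycle: the second component of the lift, on the first syzygy. *)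
pose phi : {linear syzygy (bimod A) 1 -> bimod A} :=
  HB.pack (fun x : syzygy (bimod A) 1 => dext_snd (dext_lift (kernel_val x)))
    (GRing.isLinear.Build _ _ _ _ _ dext_snd_ker_linear).
pose f : cochain (bimod A) (bimod A) 1 :=
  mk_homR (phi \o @cover_map _ (syzygy (bimod A) 1)).
have cf : f \in @cocycle _ (bimod A) (bimod A) 1.
  apply/eqP/val_inj/funext => x /=.
  have -> : cover_map (@res_d _ (bimod A) 1 x) = 0.
    by apply/res_exact; exists x.
  exact: (raddf0 phi).
exists (\pi_(HH 1 A) (Cocycle cf))%qT.
have <- : (\pi_(HH 1 A) 0)%qT = 0 :> HH 1 A by exact: pi_zeror.
rewrite -Quotient.idealrBE subr0.
apply/asboolP => -[g /(congr1 val) /= gE].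
have gP (x : kernel (bimod A)) :
    dext_snd (dext_lift (kernel_val x)) = g (kernel_val x).
  have := congr1 (fun h : res (bimod A) 1 -> bimod A =>
    h << 1 *g (x : syzygy (bimod A) 1) >>) gE.
  by rewrite /= /res_d cover_mapU scale1r.
have gB (X Y : enveloping A) (m m' : bimod A) : X *: m = Y *: m' ->
    dtwist X m - dtwist Y m' = (g << X *g m >> - g << Y *g m' >> : A).
  move=> e; have K : (<< X *g m >> - << Y *g m' >>) \in @cover_ker _ (bimod A).
    by apply/eqP; rewrite raddfB /= !cover_mapU e subrr.
  have := gP (Kernel K); rewrite /= !raddfB /= => <-.
  by rewrite !dext_liftU /dext_snd /= !scaler0 !add0r.
apply: outer; exists (g << 1 *g (1 : A) >>) => b.
have gZ (X : enveloping A) (m : bimod A) :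
    g << X *g m >> = bimod_act X (g << 1 *g m >>).
  by rewrite -[RHS](linearZZ g) freegZU mulr1.
set u : A := g << 1 *g (1 : bimod A) >>.
set w : A := g << 1 *g (b : bimod A) >>.
have gl : g << ptens 1 (b : A^c) *g (1 : bimod A) >> = u * b :> A.
  by rewrite gZ [LHS]bimod_act_ptens mul1r.
have gr : g << ptens b (1 : A^c) *g (1 : bimod A) >> = b * u :> A.
  by rewrite gZ [LHS]bimod_act_ptens mulr1.
have := gB (ptens b (1 : A^c)) 1 (1 : A) b.
have := gB (ptens 1 (b : A^c)) 1 (1 : A) b.
rewrite gl gr ![_ *: _]bimod_act_ptens ![dtwist _ _]dtwist_ptens derivation1.
rewrite !mul1r !mulr1 !mulr0 !subr0 -/w => /(_ erefl) -> /(_ erefl)/esym/eqP.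
by rewrite subr_eq0 => /eqP ->.
Qed.

End ExtensionModule.

(** * Sums over orbits of prime length *)

Lemma card_porbit_prime (p : nat) (T : finType) (s : {perm T}) (x : T) :
  prime p -> (s ^+ p = 1)%g -> s x != x -> #|porbit s x| = p.
Proof.
move=> p_pr sp sx.
have dv : (#|porbit s x| %| p)%N.
  rewrite porbitE; apply: dvdn_trans (dvdn_orbit _ _ _) _.
  by rewrite -[#|_|]/(#[s]%g) order_dvdn sp.
have /primeP[_ /(_ _ dv)/orP[/eqP c1|/eqP//]] := p_pr.
by have := iter_porbit s x; rewrite c1 /= => sxx; rewrite sxx eqxx in sx.
Qed.

Section PrimeOrbits.
Variables (p : nat) (T : finType) (f : T -> T).
Hypotheses (p_pr : prime p) (fp : forall x, iter p f x = x).

Lemma iter_prime_inj : injective f.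
Proof.
case: p p_pr fp => // q _ fq x y /(congr1 (iter q f)).
by rewrite -!iterSr !fq.
Qed.

(** The terms are grouped by the orbits of [f], each of which has [p] elements
    since [p] is prime. *)
Lemma sum_prime_orbits (V : zmodType) (F : T -> V) :
    (forall x, f x != x -> \sum_(j < p) F (iter j f x) = 0) ->
  \sum_(x | f x != x) F x = 0.
Proof.
move=> F0; pose s := perm iter_prime_inj.
have sp : (s ^+ p = 1)%g.
  by apply/permP => y; rewrite permX perm1 (eq_iter (permE _)) fp.
rewrite (partition_big (porbit s) predT) //= big1 // => O _.
have [/existsP[x /andP[fx /eqP <-]]|/existsPn n0] :=
  boolP [exists x, (f x != x) && (porbit s x == O)]; last first.
  by rewrite big_pred0 // => x; apply: negbTE.
have sx : s x != x by rewrite permE.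
rewrite -[RHS](F0 x fx) -(card_porbit_prime p_pr sp sx).
transitivity (\sum_(y in porbit s x) F y).
  apply: eq_bigl => y; rewrite eq_porbit_mem andbC.
  have [/porbitP[i ->]|//] := boolP (y \in porbit s x).
  have fi : forall i, f ((s ^+ i)%g x) = (s ^+ i)%g (f x).
    move=> j; rewrite -(permE iter_prime_inj) -/s -permM -expgSr expgS.
    by rewrite permM permE.
  by rewrite fi (inj_eq perm_inj) fx.
rewrite (eq_bigl _ _ (porbit_traject s x)) -big_uniq ?uniq_traject_porbit //=.
rewrite -(mkseq_nth x (traject s x _)) size_traject big_map -val_enum_ord.
rewrite big_map big_enum; apply: eq_bigr => i _.
rewrite nth_traject; last exact: ltn_ord.
by congr F; apply: eq_iter => y; rewrite permE.
Qed.

(** A non-fixed orbit contributes [p] equal terms. *)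
Lemma sum_prime_orbits_fix (k : fieldType) (V : lmodType k) (F : T -> V) :
    p \in [pchar k] -> (forall x, F (f x) = F x) ->
  \sum_x F x = \sum_(x | f x == x) F x.
Proof.
move=> pk Ff; rewrite (bigID (fun x => f x == x)) /=.
rewrite [X in _ + X]sum_prime_orbits ?addr0 // => x _.
have Fi j : F (iter j f x) = F x by elim: j => //= j; rewrite Ff.
under eq_bigr do rewrite Fi.
by rewrite sumr_const card_ord -scaler_nat (pcharf0 pk) scale0r.
Qed.

End PrimeOrbits.

(** * Elements of the group algebra as functions *)

Section GroupAlgebra.
Variables (k : fieldType) (gT : finGroupType).
Implicit Types (a b e v : galg k gT) (g h t u x y : gT).

Lemma galgME a b h : (a * b) h = \sum_g a g * b (g^-1 * h)%g.
Proof. by rewrite ffunE. Qed.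

Lemma gelt_mulE g a h : (gelt k g * a) h = a (g^-1 * h)%g.
Proof.
rewrite galgME (bigD1 g) //= big1 => [|u /negbTE ug].
  by rewrite ffunE eqxx mul1r addr0.
by rewrite ffunE ug mul0r.
Qed.

Lemma mul_geltE g a h : (a * gelt k g) h = a (h * g^-1)%g.
Proof.
rewrite galgME (bigD1 (h * g^-1)%g) //= big1 => [|u /eqP ne].
  by rewrite ffunE invMg invgK mulgKV eqxx mulr1 addr0.
rewrite ffunE; case: eqP => [e|]; last by rewrite mulr0.
by case: ne; rewrite -e invMg invgK mulKVg.
Qed.

Definition class_fun b := forall h g, b (h ^ g)%g = b h.

Lemma commr_gelt b g :
  GRing.comm b (gelt k g) <-> forall h, b (h ^ g)%g = b h.
Proof.
split=> [bg h|bg].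
  have /ffunP/(_ (h * g)%g) := bg.
  by rewrite mul_geltE gelt_mulE mulgK => ->.
apply/ffunP => h; rewrite mul_geltE gelt_mulE -bg conjgE.
by rewrite -!mulgA mulVg mulg1.
Qed.

Lemma gconjE a g h : gconj a g h = a (h ^ g^-1)%g.
Proof. by rewrite mul_geltE gelt_mulE conjgE invgK mulgA. Qed.

Lemma reltrace1E a h : reltrace 1%g a h = \sum_g a (h ^ g)%g.
Proof.
rewrite /reltrace sum_ffunE.
rewrite [RHS](reindex_inj invg_inj) /=.
rewrite (reindex_onto (fun g => [set g]) repr) /=; last first.
  by move=> C /rcosetsP[g _ ->]; rewrite mul1g repr_set1.
apply: eq_big => [g|g _]; last by rewrite gconjE repr_set1.
by rewrite repr_set1 eqxx andbT -[[set g]]mul1g mem_rcosets mul1g inE.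
Qed.

(** Put on one representative [r] of each class the value of [b] divided by the
    order of the centralizer of [r]; the trace spreads it over the class, each
    element being reached once for each element of the centralizer. *)
Lemma trace1_of_pregular_centralizers p b :
    p \in [pchar k] -> class_fun b ->
    (forall h, (p %| #|'C[h]%g|)%N -> b h = 0) ->
  exists2 a : galg k gT, gfixed 1%g a & reltrace 1%g a = b.
Proof.
move=> pk bcl b0.
pose a : galg k gT :=
  [ffun h => if h == repr (h ^: setT)%g then b h / #|'C[h]%g|%:R else 0].
exists a.
  by move=> g /set1P ->; apply/ffunP => h; rewrite gconjE invg1 conjg1.
apply/ffunP => h; rewrite reltrace1E.
pose r := repr (h ^: setT)%g.
have /imsetP[g0 _ rE] : r \in (h ^: setT)%g.
  by apply: (mem_repr h); apply: class_refl.
rewrite (bigID (fun g => (h ^ g)%g == r)) /= [X in _ + X]big1 ?addr0; last first.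
  move=> g ngr; rewrite ffunE.
  by rewrite (class_eqP (memJ_class h (in_setT g))) (negbTE ngr).
have cardC g : #|'C[h ^ g]%g| = #|'C[h]%g| by rewrite cent1J cardJg.
transitivity (\sum_(g | (h ^ g)%g == r) b h / #|'C[h]%g|%:R).
  apply: eq_bigr => g /eqP e; rewrite ffunE.
  by rewrite (class_eqP (memJ_class h (in_setT g))) -/r e eqxx -e bcl cardC.
rewrite sumr_const.
have -> : #|[pred g | (h ^ g)%g == r]| = #|'C[h]%g|.
  rewrite -(card_rcoset _ g0); apply: eq_card => g.
  rewrite inE mem_rcoset rE cent1C (sameP cent1P commgP).
  rewrite -(sameP eqP conjg_fixP) conjgM.
  by rewrite -[X in _ = (_ == X)](conjgK g0) (inj_eq (conjg_inj _)).
have [pd|pnd] := boolP (p %| #|'C[h]%g|)%N.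
  by rewrite b0 // mul0r mul0rn.
by rewrite -[LHS]mulr_natr divfK // -(dvdn_pcharf pk).
Qed.

(** * Brauer images of central idempotents *)

Section PrimeCharacteristic.
Variable p : nat.
Hypotheses (p_pr : prime p) (pk : p \in [pchar k]).

Lemma iter_conjg j x h : iter j (conjg^~ x) h = (h ^ (x ^+ j))%g.
Proof. by elim: j => [|j IH]; rewrite ?conjg1 //= IH -conjgM -expgSr. Qed.

Lemma sum_conjg_fix x (F : gT -> k) :
    (x ^+ p = 1)%g -> (forall h, F (h ^ x)%g = F h) ->
  \sum_h F h = \sum_(h | (h ^ x)%g == h) F h.
Proof.
move=> xp Fx; apply: (sum_prime_orbits_fix (V := k^o) p_pr _ pk Fx) => h.
by rewrite iter_conjg xp conjg1.
Qed.

(** The Brauer morphism at the subgroup generated by [x]: restriction of the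
    coefficients to the centralizer of [x]. *)
Definition brauer x b : galg k gT :=
  [ffun h => if (h ^ x)%g == h then b h else 0].

(** A coefficient of [b * b] at an element [h] of the centralizer of [x] is a sum
    over the factorizations of [h]; [x] permutes these by conjugation, and
    only the factorizations inside the centralizer are fixed. *)
Lemma brauer_idem x b :
    (x ^+ p = 1)%g -> class_fun b -> b * b = b ->
  brauer x b * brauer x b = brauer x b.
Proof.
move=> xp bcl bb; apply/ffunP => h; rewrite galgME [RHS]ffunE.
case: eqP => [hx|hx]; last first.
  rewrite big1 // => g _; rewrite !ffunE.
  case: eqP => [gx|_]; last by rewrite mul0r.
  case: eqP => [gh|_]; last by rewrite mulr0.
  by case: hx; rewrite conjMg conjVg gx in gh; move/mulgI: gh.
rewrite -[in RHS]bb galgME [RHS](sum_conjg_fix xp); last first.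
  move=> g; rewrite bcl; congr (_ * _).
  by rewrite -[RHS](bcl _ x) conjMg conjVg hx.
rewrite (bigID (fun g => (g ^ x)%g == g)) /= [X in _ + X]big1 ?addr0; last first.
  by move=> g /negbTE gx; rewrite ffunE gx mul0r.
apply: eq_bigr => g gx; rewrite !ffunE gx; case: eqP => // -[].
by rewrite conjMg conjVg (eqP gx) hx.
Qed.

Lemma pchar_galg : p \in [pchar (galg k gT)].
Proof. by rewrite pchar_lalg. Qed.

Lemma gelt_sub1_nilpotent u : (u ^+ p = 1)%g -> (gelt k u - 1) ^+ p = 0.
Proof.
move=> up; rewrite -(pFrobenius_autE pchar_galg).
rewrite pFrobenius_autB_comm; last exact: commr1.
rewrite !pFrobenius_autE expr1n.
have -> : gelt k u ^+ p = gelt k (u ^+ p)%g.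
  by elim: (p) => // j IHj; rewrite exprS expgS geltM IHj.
by rewrite up gelt1 subrr.
Qed.

(** A nonzero module over a finite abelian group of exponent [p] has a nonzero
    fixed vector in characteristic [p]. The generators are
    treated one at a time: since [gelt u - 1] is nilpotent, the last nonzero
    vector [(gelt u - 1) ^ m v] is fixed by [u], and it is still fixed by the
    generators already treated, which commute with [u]. *)
Lemma exists_fixed_vector (P : galg k gT -> Prop) (s : seq gT) v :
    (forall a b, P a -> P b -> P (a - b)) ->
    (forall u a, u \in s -> P a -> P (gelt k u * a)) ->
    {in s &, forall u t, commute u t} -> {in s, forall u, (u ^+ p = 1)%g} ->
    P v -> v != 0 ->
  exists v', [/\ P v', v' != 0 & {in s, forall u, gelt k u * v' = v'}].
Proof.
move=> PB Pu; elim: s Pu => [|u s IH] Pu cs ps Pv v0; first by exists v.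
have [|||//|//|v1 [Pv1 v10 v1s]] := IH.
- by move=> t a ts; apply: Pu; rewrite inE ts orbT.
- by move=> t t' ts ts'; apply: cs; rewrite inE ?ts ?ts' orbT.
- by move=> t ts; apply: ps; rewrite inE ts orbT.
pose w := gelt k u - 1.
have wp : w ^+ p = 0 by apply: gelt_sub1_nilpotent; rewrite ps ?mem_head.
have ex : exists m, w ^+ m * v1 == 0 by exists p; rewrite wp mul0r.
case: (ex_minnP ex) => -[|m]; first by rewrite mul1r (negbTE v10).
move=> /eqP wm min; exists (w ^+ m * v1); split.
- elim: (m) => [|j IHj]; first by rewrite mul1r.
  rewrite exprS -mulrA mulrBl mul1r; apply: PB => //.
  by apply: Pu; rewrite ?mem_head.
- by apply/negP => /min; rewrite ltnn.
- move=> t; rewrite inE => /predU1P[->|ts].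
    by apply/eqP; rewrite -subr_eq0 -{2}[_ * v1]mul1r -mulrBl mulrA -exprS wm.
  have tw : GRing.comm (gelt k t) (w ^+ m).
    apply/commrX/commrB; last exact: commr1.
    by rewrite /GRing.comm -!geltM cs // inE ?eqxx ?ts ?orbT.
  by rewrite mulrA tw -mulrA v1s.
Qed.

(** The Brauer image [e] of [b] at [x] is a nonzero idempotent, and the conjugates
    of [y] under the centralizer of [x] generate an elementary abelian normal
    subgroup of that centralizer, so the left ideal of [e] contains a nonzero
    vector [v = e v] fixed by all of them. If no [h] in the support of [b]
    commutes with [y], then in [e v], the sum of the [e h] times [h v],
    conjugation by [y] has no fixed term while it preserves the terms, because
    [h v] is fixed by [y] and [y h v = h (y ^ h) v = h v]. Hence [v = 0]. *)
Lemma support_meets_centralizer x y b h0 :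
    (x ^+ p = 1)%g -> (y ^+ p = 1)%g -> commute x y ->
    {in 'C[x]%g &, forall u t, commute (y ^ u)%g (y ^ t)%g} ->
    class_fun b -> b * b = b -> (h0 ^ x)%g = h0 -> b h0 != 0 ->
  exists2 h, (h ^ y)%g = h & b h != 0.
Proof.
move=> xp yp xy ycomm bcl bb h0x bh0.
have [/existsP[h /andP[/eqP hy bh]]|/existsPn nh] :=
  boolP [exists h, ((h ^ y)%g == h) && (b h != 0)]; first by exists h.
pose e := brauer x b.
have ee : e * e = e := brauer_idem xp bcl bb.
have e0 : e != 0.
  by apply/eqP => /ffunP/(_ h0)/eqP; rewrite !ffunE h0x eqxx (negbTE bh0).
have cxP u : reflect ((u ^ x)%g = u) (u \in 'C[x]%g).
  rewrite (sameP cent1P commgP); exact: conjg_fixP.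
have ecomm u : u \in 'C[x]%g -> forall h, e (h ^ u)%g = e h.
  move=> ux h; rewrite !ffunE bcl -conjgM.
  have -> : (u * x)%g = (x * u)%g by exact/cent1P.
  by rewrite conjgM (inj_eq (conjg_inj _)).
have [||||//|//|v [ev v0 vfix]] := @exists_fixed_vector (fun a => e * a = a)
    (enum (y ^: 'C[x])%g) e.
- by move=> a a' ea ea'; rewrite mulrBr ea ea'.
- move=> u1 a; rewrite mem_enum => /imsetP[u ux ->] ea.
  have eyu : GRing.comm e (gelt k (y ^ u)%g).
    apply/commr_gelt/ecomm; rewrite groupJ //; exact/cent1P.
  by rewrite mulrA eyu -mulrA ea.
- move=> u1 t1; rewrite !mem_enum => /imsetP[u ux ->] /imsetP[t tx ->].
  exact: ycomm.
- by move=> u1; rewrite mem_enum => /imsetP[u _ ->]; rewrite -conjXg yp conj1g.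
case/eqP: v0; apply/ffunP => t; rewrite -ev galgME [RHS]ffunE.
have vE u s : u \in 'C[x]%g -> v ((y ^ u)^-1 * s)%g = v s.
  move=> ux; rewrite -gelt_mulE vfix // mem_enum; exact: memJ_class.
rewrite (sum_conjg_fix yp) => [|h].
  rewrite big1 // => h hy; rewrite ffunE.
  move: (nh h); rewrite hy /= negbK => /eqP ->.
  by case: ifP; rewrite mul0r.
rewrite ecomm; last exact/cent1P.
have [hx|hx] := boolP (h \in 'C[x]%g); last first.
  rewrite [e h]ffunE; case: eqP => [/cxP|]; first by rewrite (negbTE hx).
  by rewrite !mul0r.
congr (_ * _); rewrite conjgE !invMg invgK -!mulgA.
rewrite -[in LHS](conjg1 y) vE ?group1 // conjg1.
rewrite -[LHS](vE h) // conjgE !invMg invgK -!mulgA; congr (v _).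
by rewrite mulKVg mulKg.
Qed.

End PrimeCharacteristic.
End GroupAlgebra.

(** * Derivations from 1-cocycles *)

Section CocycleDerivation.
Variables (k : fieldType) (gT : finGroupType).
Variables (Y : {pred gT}) (phi : gT -> gT -> k).
Hypothesis YJ : forall y g, ((y ^ g)%g \in Y) = (y \in Y).
Hypothesis phiM : forall y g h, y \in Y ->
  phi y (g * h)%g = phi y g + phi (y ^ g)%g h.
Implicit Types (a b e u v : galg k gT) (g h t x y : gT).

(** The derivation sending the group element [g] to the sum of the
    [phi y g *: gelt (y * g)] over [y] in [Y]. Here [phi] is a 1-cocycle of the
    group with values in the permutation module on [Y], so that its class lies
    in the direct summand of HH^1 of the group algebra belonging to [Y]. *)
Definition cocycle_der a : galg k gT :=
  [ffun h => \sum_(y in Y) phi y (y^-1 * h)%g * a (y^-1 * h)%g].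

Fact cocycle_der_is_linear : linear cocycle_der.
Proof.
move=> z a b; apply/ffunP => h; rewrite !ffunE scaler_sumr -big_split /=.
by apply: eq_bigr => y _; rewrite !ffunE mulrDr; congr (_ + _); rewrite mulrCA.
Qed.
HB.instance Definition _ :=
  GRing.isLinear.Build k _ _ _ cocycle_der cocycle_der_is_linear.

Lemma cocycle_derM a b :
  cocycle_der (a * b) = cocycle_der a * b + a * cocycle_der b.
Proof.
apply/ffunP => h; rewrite ffunE [RHS]ffunE !galgME.
have -> : \sum_g cocycle_der a g * b (g^-1 * h)%g =
    \sum_(y in Y) \sum_g phi y g * a g * b (g^-1 * (y^-1 * h))%g.
  under eq_bigr => g _ do rewrite ffunE mulr_suml.
  rewrite exchange_big /=; apply: eq_bigr => y _.
  rewrite (reindex_inj (mulgI y)) /=; apply: eq_bigr => g _.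
  by rewrite mulKg invMg -mulgA.
have -> : \sum_g a g * cocycle_der b (g^-1 * h)%g =
    \sum_(y in Y) \sum_g
      phi (y ^ g)%g (g^-1 * (y^-1 * h))%g * a g * b (g^-1 * (y^-1 * h))%g.
  rewrite [RHS]exchange_big /=; apply: eq_bigr => g _.
  rewrite ffunE (reindex_inj (conjg_inj g)) /= mulr_sumr.
  rewrite (eq_bigl _ _ (YJ^~ g)); apply: eq_bigr => y _.
  rewrite conjgE !invMg invgK -!mulgA mulKVg.
  by rewrite mulrCA mulrA.
rewrite -big_split; apply: eq_bigr => y yY /=.
rewrite galgME mulr_sumr -big_split; apply: eq_bigr => g _ /=.
by rewrite -!mulrDl -phiM // mulKVg mulrA.
Qed.

Lemma cocycle_der_gelt x h :
  cocycle_der (gelt k x) (h * x)%g = if h \in Y then phi h x else 0.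
Proof.
rewrite ffunE big_mkcond (bigD1 h) //= big1 => [|y ny].
  by rewrite mulKg ffunE eqxx addr0 mulr1.
rewrite ffunE; case: eqP => [e|]; last by rewrite mulr0 if_same.
by case/eqP: ny; move/(congr1 (mulg y)): e; rewrite mulKVg => /mulIg.
Qed.

Section PrimeCharacteristic.
Variable p : nat.
Hypotheses (p_pr : prime p) (pk : p \in [pchar k]).

(** The part in the centralizer of [x] of [cocycle_der (gelt x) * gelt x^-1]. *)
Definition cocycle_residue x : galg k gT :=
  \sum_(y in Y | (y ^ x)%g == y) phi y x *: gelt k y.

(** The sum telescopes to [phi y (x ^+ p)], and a cocycle vanishes at [1]. *)
Lemma cocycle_orbit_sum x y : (x ^+ p = 1)%g -> y \in Y ->
  \sum_(j < p) phi (y ^ (x ^+ j))%g x = 0.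
Proof.
move=> xp yY.
have phi1 : phi y 1%g = 0.
  by apply: (addrI (phi y 1%g)); rewrite addr0 -{2}(conjg1 y) -phiM // mulg1.
suff phiX m : \sum_(j < m) phi (y ^ (x ^+ j))%g x = phi y (x ^+ m)%g.
  by rewrite phiX xp.
elim: m => [|m IH]; first by rewrite big_ord0 phi1.
by rewrite big_ord_recr IH expgSr phiM.
Qed.

(** Compare the coefficients of the hypothesis at [t x], for [t] commuting with
    [x]. On the right they are [u t - u (t ^ x)], which is zero. On the left,
    the terms indexed by the [y] not commuting with [x] add up to zero
    over each orbit of [x], by [cocycle_orbit_sum]. *)
Lemma inner_kills_residue x b u :
    (x ^+ p = 1)%g -> class_fun b ->
    (b * cocycle_der (gelt k x) = u * gelt k x - gelt k x * u) ->
  brauer x b * cocycle_residue x = 0.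
Proof.
move=> xp bcl inner; apply/ffunP => t; rewrite [RHS]ffunE.
rewrite mulr_sumr sum_ffunE.
under eq_bigr => y _ do rewrite -scalerAr ffunE mul_geltE ffunE.
have [tx|tx] := eqVneq (t ^ x)%g t; last first.
  rewrite big1 // => y /andP[_ /eqP yx].
  case: eqP => [e|]; last by rewrite scaler0.
  by rewrite conjMg conjVg yx in e; rewrite (mulIg _ _ _ e) eqxx in tx.
transitivity (\sum_y (if y \in Y then phi y x else 0) * b (t * y^-1)%g);
  last first.
  transitivity ((b * cocycle_der (gelt k x)) (t * x)%g).
    rewrite galgME [RHS](reindex_inj invg_inj).
    rewrite [RHS](reindex_inj (mulIg (t^-1)%g)) /=.
    apply: eq_bigr => y _; rewrite -cocycle_der_gelt mulrC; congr (_ * _).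
      by rewrite invMg invgK.
    by rewrite invgK -mulgA mulKg.
  rewrite inner ffunE [X in _ + X]ffunE mul_geltE gelt_mulE mulgK.
  by rewrite -conjgE tx subrr.
rewrite [RHS](bigID (fun y => (y ^ x)%g == y)) /=.
rewrite [X in _ + X](@sum_prime_orbits p _ (conjg^~ x) p_pr).
- rewrite addr0 [RHS]big_mkcond [LHS]big_mkcond; apply: eq_bigr => y _.
  case yY: (y \in Y); case: eqP => //= yx; rewrite ?mul0r //.
  by rewrite conjMg conjVg tx yx eqxx.
- by move=> h; rewrite iter_conjg xp conjg1.
move=> y _; have [yY|nyY] := boolP (y \in Y); last first.
  by rewrite big1 // => j _; rewrite iter_conjg YJ (negbTE nyY) mul0r.
transitivity (\sum_(j < p) phi (y ^ (x ^+ j))%g x * b (t * y^-1)%g).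
  apply: eq_bigr => j _; rewrite iter_conjg YJ yY; congr (_ * _).
  have tj : (t ^ (x ^+ j))%g = t.
    by elim: (j : nat) => [|i IH]; rewrite ?conjg1 // expgS conjgM tx.
  by rewrite -[in RHS](bcl _ (x ^+ j)%g) conjMg conjVg tj.
by rewrite -mulr_suml cocycle_orbit_sum // mul0r.
Qed.

(** The coefficients of [e] are constant on the cosets of [x], so the terms of
    each coefficient of [e * e] are constant on the orbits of translation by
    [x], and translation has no fixed point. *)
Lemma idem_absorbing_torsion_eq0 x e : (x ^+ p = 1)%g -> x != 1%g ->
  e * e = e -> e * gelt k x = e -> GRing.comm e (gelt k x) -> e = 0.
Proof.
move=> xp x1 ee ex cex; apply/ffunP => t; rewrite -ee galgME [RHS]ffunE.
have fix0 g : (g * x)%g != g by rewrite -{2}[g]mulg1 (inj_eq (mulgI g)).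
have iterx j g : iter j (mulg^~ x) g = (g * x ^+ j)%g.
  by elim: j => [|j IH]; rewrite ?mulg1 //= IH expgSr mulgA.
rewrite (sum_prime_orbits_fix (V := k^o) (f := mulg^~ x) p_pr _ pk).
- by rewrite big_pred0 // => g; apply: negbTE.
- by move=> g; rewrite iterx xp mulg1.
move=> g; congr (_ * _); first by rewrite -{1}ex mul_geltE mulgK.
by rewrite -[in RHS]ex cex gelt_mulE invMg mulgA.
Qed.

(** Under the hypothesis on powers, the residue is a combination of the powers
    of [x] that is congruent to a scalar plus [N] times [x - 1] modulo
    [(x - 1) ^ 2], where [N] counts some nontrivial powers of [x], including
    [x] itself, so that [N] is not zero in [k]. If [e] is nonzero then it is not
    killed by [x - 1], so some [v] in the left ideal of [e] is killed by
    [(x - 1) ^ 2] but not by [x - 1]; the residue cannot kill [v]. The shape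
    [w ^+ m * e] of [v] is chosen so that the residue meets [e] first. *)
Lemma idem_killing_residue_eq0 x e :
    (x ^+ p = 1)%g -> x != 1%g -> x \in Y -> phi x x != 0 ->
    (forall y, y \in Y -> (y ^ x)%g = y -> phi y x != 0 ->
      exists2 i, y = (x ^+ i)%g & i%:R * phi y x = 1) ->
    e * e = e -> GRing.comm e (gelt k x) -> e * cocycle_residue x = 0 ->
  e = 0.
Proof.
move=> xp x1 xY phixx powers ee cex eL.
pose w := gelt k x - 1.
have wp : w ^+ p = 0 by apply: gelt_sub1_nilpotent.
have ex : exists m, w ^+ m * e == 0 by exists p; rewrite wp mul0r.
case: (ex_minnP ex) => -[|[|m]] /eqP wm min.
- by rewrite mul1r in wm.
- apply: (idem_absorbing_torsion_eq0 xp x1 ee) => //.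
  by apply/eqP; rewrite cex -subr_eq0 -{2}[e]mul1r -mulrBl -wm expr1.
pose v := w ^+ m * e.
have cew : GRing.comm e w by apply: commrB => //; exact: commr1.
have vwE : v * w = w ^+ m.+1 * e by rewrite /v -mulrA cew mulrA -exprSr.
have vw0 : v * w != 0 by rewrite vwE; apply/negP => /min; rewrite ltnn.
have vww : v * w * w = 0 by rewrite vwE -mulrA cew mulrA -exprSr.
have vx i : v * gelt k (x ^+ i)%g = v + (i%:R : k) *: (v * w).
  elim: i => [|i IH]; first by rewrite gelt1 mulr1 scale0r addr0.
  have -> : gelt k (x ^+ i.+1)%g = gelt k (x ^+ i)%g * (w + 1).
    by rewrite subrK -geltM expgSr.
  rewrite mulrA IH mulrDr mulr1 mulrDl -scalerAl vww scaler0 addr0.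
  by rewrite addrCA -natr1 scalerDl scale1r; congr (v + _); rewrite addrC.
pose N := [set y in Y | ((y ^ x)%g == y) && (phi y x != 0)].
pose S := \sum_(y in N) phi y x.
have vL : S *: v + (#|N|%:R : k) *: (v * w) = 0.
  have <- : v * cocycle_residue x = 0 by rewrite /v -mulrA eL mulr0.
  rewrite mulr_sumr [in RHS](bigID (fun y => phi y x != 0)) /=.
  rewrite [X in _ = _ + X]big1 ?addr0.
    rewrite -sum1_card natr_sum !scaler_suml -big_split.
    apply: eq_big => [y|y]; rewrite inE ?andbA // => /andP[/andP[yY /eqP yx] y0].
    have [i yE ip] := powers y yY yx y0.
    by rewrite -scalerAr {3}yE vx scalerDr scalerA [_ * i%:R]mulrC ip.
  by move=> y /andP[_]; rewrite negbK => /eqP ->; rewrite scale0r mulr0.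
(* Multiplication by w leaves only the scalar term S. *)
have S0 : S = 0.
  have := congr1 (fun a => a * w) vL.
  rewrite mul0r mulrDl -!scalerAl vww scaler0 addr0.
  by move/eqP; rewrite scaler_eq0 (negbTE vw0) orbF => /eqP.
move/eqP: vL; rewrite S0 scale0r add0r scaler_eq0 (negbTE vw0) orbF.
rewrite -(dvdn_pcharf pk).
have N1 : (0 < #|N|)%N.
  by apply/card_gt0P; exists x; rewrite inE xY conjgE mulKg eqxx.
move/(dvdn_leq N1); rewrite leqNgt => /negP[].
have <- : #[x]%g = p by apply: nt_prime_order.
rewrite orderE (cardsD1 1%g <[x]>%g) group1 ltnS.
apply/subset_leq_card/subsetP => y.
rewrite inE => /and3P[yY /eqP yx y0]; have [i yE ip] := powers y yY yx y0.
rewrite !inE yE mem_cycle andbT; apply/eqP => xi1.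
have : i%:R != 0 :> k.
  by apply/eqP => i0; move/eqP: ip; rewrite i0 mul0r eq_sym oner_eq0.
rewrite -(dvdn_pcharf pk) => /negP; apply.
have -> : p = #[x]%g by apply/esym/nt_prime_order.
by rewrite order_dvdn xi1.
Qed.

End PrimeCharacteristic.
End CocycleDerivation.

(** * The shift cocycle on prime cycles *)

Section PrimeCycles.
Variables (p : nat) (T : finType).
Hypothesis p_pr : prime p.
Implicit Types (x y z g h : {perm T}) (a c : T).

Lemma perm_commute_partial x y z (P Q : pred T) :
    (forall c, P (x c) = P c) -> (forall c, Q (x c) = Q c) ->
    (forall c, y c = if P c then x c else c) ->
    (forall c, z c = if Q c then x c else c) ->
  commute y z.
Proof.
move=> Px Qx yE zE; apply/permP => c; rewrite !permM !yE !zE.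
by case Pc: (P c); case Qc: (Q c); rewrite ?Px ?Qx ?Pc ?Qc.
Qed.

Definition prime_cycle y :=
  (y ^+ p == 1)%g &&
  [exists c, (y c != c) && [forall d, (y d != d) ==> (d \in porbit y c)]].

(** Take for [y] the restriction of [x] to one nontrivial orbit. Its conjugates
    by elements commuting with [x] are again restrictions of [x] to [x]-stable
    sets, so they commute with each other. *)
Lemma prime_cycle_of_order x a : (x ^+ p = 1)%g -> x a != a ->
  exists y, [/\ prime_cycle y, commute x y &
    {in 'C[x]%g &, forall g h, commute (y ^ g)%g (y ^ h)%g}].
Proof.
move=> xp xa; pose S := porbit x a; pose y := restr_perm S x.
have Sx c : (x c \in S) = (c \in S).
  by rewrite -!eq_porbit_mem -[x c]/((x ^+ 1)%g c) porbit_perm.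
have xN : x \in 'N(S | 'P)%g by apply/astabsP => c; rewrite [_ c x]apermE Sx.
have yE c : y c = if c \in S then x c else c.
  case: ifP => [cS|/negbT cS]; first exact: restr_permE.
  by apply: (out_perm (restr_perm_on S x)).
have yX j c : c \in S -> (y ^+ j)%g c = (x ^+ j)%g c.
  move=> cS; elim: j => [|j IH]; first by rewrite !perm1.
  rewrite !expgSr !permM IH yE.
  have -> : (x ^+ j)%g c \in S.
    by rewrite -eq_porbit_mem porbit_perm eq_porbit_mem.
  by [].
have yJ g c : g \in 'C[x]%g ->
    (y ^ g)%g c = if (g^-1)%g c \in S then x c else c.
  move=> /cent1P gx; rewrite -{1}(permKV g c) permJ yE.
  by case: ifP; rewrite ?permKV // -permM -gx permM permKV.
exists y; split.
- apply/andP; split.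
    apply/eqP/permP => c; rewrite perm1; have [cS|cS] := boolP (c \in S).
      by rewrite yX // xp perm1.
    by elim: (p) => [|j IH]; rewrite ?perm1 // expgSr permM IH yE (negbTE cS).
  apply/existsP; exists a; rewrite yE porbit_id xa /=; apply/forallP => d.
  apply/implyP; rewrite yE; case: ifP => [/porbitP[j ->] _|]; last first.
    by rewrite eqxx.
  by rewrite -yX ?porbit_id // mem_porbit.
- by apply: (@perm_commute_partial x x y predT (mem S)).
move=> g h gx hx.
have st u : u \in 'C[x]%g ->
    forall c, ((u^-1)%g (x c) \in S) = ((u^-1)%g c \in S).
  move=> /groupVr/cent1P ux c; rewrite -permM -ux permM; exact: Sx.
by apply: (perm_commute_partial (st g gx) (st h hx)) => c; apply: yJ.
Qed.

Lemma prime_cycleJ y g : prime_cycle (y ^ g)%g = prime_cycle y.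
Proof.
suff cJ z h : prime_cycle z -> prime_cycle (z ^ h)%g.
  by apply/idP/idP => [/cJ-/(_ (g^-1)%g)|/cJ//]; rewrite conjgK.
case/andP => /eqP zp /existsP[c /andP[zc /forallP zall]].
apply/andP; split; first by rewrite -conjXg zp conj1g.
apply/existsP; exists (h c); rewrite permJ (inj_eq perm_inj) zc /=.
apply/forallP => d; rewrite -(permKV h d) permJ (inj_eq perm_inj).
apply/implyP => zd; have /implyP/(_ zd)/porbitP[j ->] := zall ((h^-1)%g d).
by apply/porbitP; exists j; rewrite -conjXg permJ.
Qed.

(** Otherwise [z] would be a power of [z ^+ (j - i)], which fixes [c]. *)
Lemma eq_perm_exp_mod z c i j : (z ^+ p = 1)%g -> z c != c ->
  (z ^+ i)%g c = (z ^+ j)%g c -> i = j %[mod p].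
Proof.
move=> zp zc; wlog ij : i j / (i <= j)%N => [W|] e.
  by case/orP: (leq_total i j) => le; [|apply/esym]; apply: W.
apply/esym/eqP; rewrite eqn_mod_dvd //; apply: contraR zc => npd.
have [z1|z1] := eqVneq z 1%g; first by rewrite z1 perm1.
have oz : #[z]%g = p by apply: nt_prime_order.
have: z \in <[z ^+ (j - i)]>%g.
  have /eqP <- : generator <[z]>%g (z ^+ (j - i)).
    by rewrite generator_coprime oz prime_coprime.
  exact: cycle_id.
case/cycleP => m zE; apply/eqP.
have fixd : (z ^+ (j - i))%g c = c.
  by apply: (@perm_inj _ (z ^+ i)%g); rewrite -permM -expgD subnK.
by rewrite zE; elim: m {zE} => [|m IH]; rewrite ?perm1 // expgSr permM IH.
Qed.

Variables (k : fieldType) (c0 : T).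
Hypothesis pk : p \in [pchar k].

Lemma eq_natr_mod i j : i = j %[mod p] -> i%:R = j%:R :> k.
Proof.
move=> ij; rewrite (divn_eq i p) (divn_eq j p) ij !natrD !natrM.
by rewrite (pcharf0 pk) !mulr0.
Qed.

(** A chosen point on the cycle of [y]; [c0] is a value for permutations that are
    not prime cycles. *)
Definition cycle_base y : T :=
  odflt c0
    [pick c | (y c != c) && [forall d, (y d != d) ==> (d \in porbit y c)]].

(** Conjugation by [g] carries the cycle of [y] onto that of [y ^ g], and
    [cycle_shift y g] is the number of steps along the latter from its chosen
    point to the image of the chosen point of the former. This is the 1-cocycle
    that Shapiro's lemma attaches to the homomorphism from the centralizer of
    [y], which is the direct product of the cyclic group of [y] and a symmetric
    group, to the additive group of [k] that sends [y] to [1] and the symmetric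
    group to [0]. *)
Definition cycle_shift y g : k :=
  if [pick j : 'I_p |
      ((y ^ g) ^+ j)%g (cycle_base (y ^ g)%g) == g (cycle_base y)]
    is Some j then (j : nat)%:R else 0.

Lemma cycle_baseP y : prime_cycle y ->
  [/\ (y ^+ p = 1)%g, y (cycle_base y) != cycle_base y &
    forall d, y d != d -> d \in porbit y (cycle_base y)].
Proof.
case/andP => /eqP yp /existsP[c yc]; rewrite /cycle_base.
case: pickP => [d|/(_ c)].
  by case/andP => yd /forallP yall; split=> // d'; apply/implyP.
by rewrite yc.
Qed.

Lemma cycle_shift_exists y g : prime_cycle y ->
  exists m, ((y ^ g) ^+ m)%g (cycle_base (y ^ g)%g) = g (cycle_base y).
Proof.
move=> yc; have [_ yb _] := cycle_baseP yc.
have [|_ _ all] := @cycle_baseP (y ^ g)%g; first by rewrite prime_cycleJ.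
have /all/porbitP[m ->] : (y ^ g)%g (g (cycle_base y)) != g (cycle_base y).
  by rewrite permJ (inj_eq perm_inj).
by exists m.
Qed.

Lemma cycle_shiftE y g m : prime_cycle y ->
    ((y ^ g) ^+ m)%g (cycle_base (y ^ g)%g) = g (cycle_base y) ->
  cycle_shift y g = m%:R.
Proof.
move=> yc mE; have [|ygp ygb _] := @cycle_baseP (y ^ g)%g.
  by rewrite prime_cycleJ.
have m_mod := ltn_pmod m (prime_gt0 p_pr).
rewrite /cycle_shift; case: pickP => [j /eqP jE|/(_ (Ordinal m_mod))].
  by apply/eq_natr_mod/(eq_perm_exp_mod ygp ygb); rewrite jE mE.
by rewrite /= expg_mod // mE eqxx.
Qed.

Lemma cycle_shiftM y g h : prime_cycle y ->
  cycle_shift y (g * h)%g = cycle_shift y g + cycle_shift (y ^ g)%g h.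
Proof.
move=> yc; have ygc : prime_cycle (y ^ g)%g by rewrite prime_cycleJ.
have [m mE] := cycle_shift_exists g yc.
have [m' m'E] := cycle_shift_exists h ygc.
rewrite (cycle_shiftE yc mE) (cycle_shiftE ygc m'E) -natrD.
apply: cycle_shiftE => //; rewrite conjgM addnC expgD !permM m'E.
by rewrite -conjXg permJ mE.
Qed.

Lemma cycle_shift_self x : prime_cycle x -> cycle_shift x x = 1.
Proof.
move=> xc; rewrite -[1]/(1%:R); apply: cycle_shiftE => //.
by rewrite conjgE mulKg.
Qed.

(** If [x] shifts the cycle of a commuting cycle [y] by [m] nonzero steps, then
    [x] equals [y ^+ m] on that cycle; so [x] moves the whole cycle of
    [y], which by cardinality is the cycle of [x], and [x = y ^+ m]. *)
Lemma cycle_shift_power x y : prime_cycle x -> prime_cycle y -> (y ^ x)%g = y ->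
    cycle_shift y x != 0 ->
  exists2 i, y = (x ^+ i)%g & i%:R * cycle_shift y x = 1.
Proof.
move=> xc yc yx; have [m] := cycle_shift_exists x yc; rewrite yx => mE.
rewrite (@cycle_shiftE y x m) ?yx // => m0.
have [yp yb yall] := cycle_baseP yc; have [xp xb xall] := cycle_baseP xc.
set b := cycle_base y in mE yb yall.
have xy : commute x y by apply/commute_sym/commgP/conjg_fixP.
have onS c : c \in porbit y b -> x c = (y ^+ m)%g c.
  case/porbitP => i ->; rewrite -permM -(commuteX i xy) permM -mE -!permM.
  by rewrite -!expgD addnC.
have ynm c : y c != c -> (y ^+ m)%g c != c.
  move=> yc'; apply: contraNneq m0 => e.
  rewrite (@eq_natr_mod m 0) //; apply: (eq_perm_exp_mod yp yc').
  by rewrite e expg0 perm1.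
have ymv c : c \in porbit y b -> y c != c.
  by case/porbitP => i ->; rewrite -permM -expgSr expgS permM (inj_eq perm_inj).
have sub : porbit y b \subset porbit x (cycle_base x).
  by apply/subsetP => c cS; apply: xall; rewrite onS // ynm // ymv.
have eqS : porbit y b = porbit x (cycle_base x).
  apply/eqP; rewrite eqEcard sub /= (card_porbit_prime p_pr xp xb).
  by rewrite (card_porbit_prime p_pr yp yb).
have xE : x = (y ^+ m)%g.
  apply/permP => c; have [cS|cS] := boolP (c \in porbit y b); first exact: onS.
  have yc' : y c = c by apply/eqP; apply: contraNT cS; apply: yall.
  have -> : x c = c by apply/eqP; apply: contraNT cS; rewrite eqS; apply: xall.
  by elim: (m) => [|j IH]; rewrite ?perm1 // expgSr permM -IH.
have npm : ~~ (p %| m)%N by rewrite (dvdn_pcharf pk).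
have oy : #[y]%g = p.
  by apply: nt_prime_order => //; apply: contraNneq yb => ->; rewrite perm1.
have: y \in <[y ^+ m]>%g.
  have /eqP <- : generator <[y]>%g (y ^+ m).
    by rewrite generator_coprime oy prime_coprime.
  exact: cycle_id.
rewrite -xE => /cycleP[i yE]; exists i => //.
rewrite -natrM -[RHS]/(1%:R); apply/eq_natr_mod/(eq_perm_exp_mod yp yb).
by rewrite mulnC expgM -xE -yE.
Qed.

End PrimeCycles.

(** * Blocks of symmetric groups *)

Section IdealFactor.
Variables (k : fieldType) (A : falgType k) (B : {aspace A}).
Hypothesis idealB : two_sided_ideal fullv B.

Let mulB a c : c \in B -> (a * c \in B) * (c * a \in B).
Proof.
have [_ lB rB] := idealB => cB.
by split; [apply: (subvP lB) | apply: (subvP rB)]; apply: memv_mul;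
  rewrite ?memvf.
Qed.

Lemma algid_ideal_comm a : GRing.comm (algid B) a.
Proof.
have bB := memv_algid B.
rewrite /GRing.comm -(algidr (mulB a bB).2) -mulrA.
by rewrite algidl // (mulB a bB).1.
Qed.

(** The derivation of [B] is [algid B * d]. It is compared with [d] on all of [A],
    not only on [B], by evaluating at [algid B * a] and using that a derivation
    kills the central idempotent [algid B] after multiplication by it. *)
Lemma HH1_ideal_nonzero (d : {linear A -> A}) :
    (forall a c, d (a * c) = d a * c + a * d c) ->
    ~ (exists u, forall a, algid B * d a = u * a - a * u) ->
  exists x : HH 1 (subvs_of B), x != 0.
Proof.
move=> dM outer; have bB := memv_algid B; set b := algid B in bB outer.
have bb : b * b = b by apply: algidl.
have db : b * d b = 0.
  have /eqP := congr1 (fun a => b * a) (dM b b).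
  rewrite bb mulrDr [b * (b * _)]mulrA bb -{1}[b * d b]add0r (inj_eq (addIr _)).
  by rewrite -(algid_ideal_comm (d b)) mulrA bb => /eqP <-.
pose dB (u : subvs_of B) : subvs_of B := vsproj B (b * d (vsval u)).
have vdB u : vsval (dB u) = b * d (vsval u).
  by rewrite vsprojK // (mulB _ bB).2.
have dB_lin : linear dB.
  by move=> z u v; rewrite /dB !linearP /= mulrDr -scalerAr linearP.
pose dBl : {linear subvs_of B -> subvs_of B} :=
  HB.pack dB (GRing.isLinear.Build _ _ _ _ _ dB_lin).
apply: (@HH1_nonzero_of_derivation k (subvs_of B) dBl).
  move=> u v; apply: val_inj; rewrite /= !vdB /= dM mulrDr !mulrA.
  by rewrite {2}/b (algid_ideal_comm (vsval u)).
case=> u uE; apply: outer; exists (vsval u) => a.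
have := congr1 val (uE (vsproj B (b * a))).
rewrite /= vdB vsprojK ?(mulB _ bB).2 // dM mulrDr.
rewrite [b * (d b * a)]mulrA db mul0r add0r [b * (b * d a)]mulrA bb => ->.
by rewrite !mulrA algidr ?subvsP // (algid_ideal_comm a) -mulrA algidl ?subvsP.
Qed.

End IdealFactor.

(** If all elements in the support of the block idempotent had centralizers of
    order prime to [p], the idempotent would be a trace from the trivial group,
    against the minimality of [D]; otherwise Cauchy's theorem gives [x]. *)
Lemma defect_nontrivial_support (p : nat) (k : fieldType) (gT : finGroupType)
    (B : {aspace galg k gT}) (D : {group gT}) :
    prime p -> p \in [pchar k] -> class_fun (algid B) ->
    is_defect_group B D -> D :!=: 1%g ->
  exists x h, [/\ #[x]%g = p, (h ^ x)%g = h & algid B h != 0].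
Proof.
move=> p_pr pk bcl [_ minD] D1.
have n1 : ~ in_trace_ideal B 1%g by apply: (minD 1%G); rewrite proper1G.
have [/existsP[h /andP[bh pC]]|/existsPn none] :=
  boolP [exists h, (algid B h != 0) && (p %| #|'C[h]%g|)%N]; last first.
  case: n1; apply: trace1_of_pregular_centralizers pk bcl _ => h pC.
  by apply/eqP; move: (none h); rewrite pC andbT negbK.
have [x xC ox] := Cauchy p_pr pC; exists x, h; split=> //.
by apply/conjg_fixP/commgP/commute_sym/cent1P.
Qed.

Theorem theorem1p1 (p : nat) (k : fieldType) (n : nat)
    (B : {aspace galg k 'S_n}) (D : {group 'S_n}) :
  prime p -> p \in [pchar k] ->
  is_block B -> is_defect_group B D -> D :!=: 1%g ->
  exists x : HH 1 (subvs_of B), x != 0.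
Proof.
move=> p_pr pk [[idealB _] _] defD D1.
have bcl : class_fun (algid B).
  by move=> h g; apply: (commr_gelt _ _).1; apply: algid_ideal_comm.
have bb : algid B * algid B = algid B by apply/algidl/memv_algid.
have [x [h0 [ox h0x bh0]]] := defect_nontrivial_support p_pr pk bcl defD D1.
have xp : (x ^+ p = 1)%g by rewrite -ox expg_order.
have [a xa] : exists a, x a != a.
  apply/existsP; apply: contraT; rewrite negb_exists => /forallP fixx.
  have x1 : x = 1%g.
    by apply/permP => a; rewrite perm1; apply/eqP; rewrite -[_ == _]negbK.
  by move: p_pr; rewrite -ox x1 order1.
have [y [yc xy ycomm]] := prime_cycle_of_order xp xa.
have [yp yb _] := cycle_baseP a yc.
have y1 : y != 1%g by apply: contraNneq yb => ->; rewrite perm1.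
have [h hy bh] :=
  support_meets_centralizer p_pr pk xp yp xy ycomm bcl bb h0x bh0.
pose Y : {pred 'S_n} := @prime_cycle p _.
have YJ z g : ((z ^ g)%g \in Y) = (z \in Y) by apply: prime_cycleJ.
pose phi := @cycle_shift p _ k a.
have phiM z g g' : z \in Y -> phi z (g * g')%g = phi z g + phi (z ^ g)%g g'.
  by move=> zY; apply: cycle_shiftM.
apply: (HH1_ideal_nonzero idealB (d := cocycle_der Y phi)).
  exact: cocycle_derM.
case=> u uE.
have res0 := inner_kills_residue YJ phiM p_pr yp bcl (uE (gelt k y)).
have e0 : brauer y (algid B) = 0.
  have phiy : phi y y = 1 by apply: cycle_shift_self.
  apply: (idem_killing_residue_eq0 p_pr pk yp y1 yc) res0.
  - by rewrite phiy oner_eq0.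
  - by move=> z zY zy; apply: cycle_shift_power.
  - exact: (brauer_idem p_pr pk yp bcl bb).
  - by apply/commr_gelt => g; rewrite !ffunE bcl (inj_eq (conjg_inj y)).
by move/ffunP/(_ h)/eqP: e0; rewrite !ffunE hy eqxx (negbTE bh).
Qed.
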